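(* Let $k$ be an infinite field (of arbitrary characteristic), let $G$ be a finite group, and let $V$ be a representation of $G$ defined over $k$. Let $x \in V$ be a vector whose orbit consists of linearly independent vectors, i.e. the $|G|$ vectors $g \cdot x$, $g \in G$, are linearly independent over $k$. Then the $G$-orbit of $x$ is uniquely determined by the invariant tensors $T^G_2(x)$ and $T^G_3(x)$; that is, if $y \in V$ satisfies $T^G_2(y) = T^G_2(x)$ and $T^G_3(y) = T^G_3(x)$, then $y = g \cdot x$ for some $g \in G$.
   Context: For a representation $V$ of a finite group $G$ over a field $k$, a vector $x \in V$ and an integer $d \geq 1$, the degree $d$ invariant tensor of $x$ is the symmetric tensor $$T^G_d(x) = \sum_{g \in G} (g \cdot x)^{\otimes d} \in V^{\otimes d}.$$ No division by $|G|$ is performed, so this is defined in every characteristic. *)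

(* Defs.v *)
From HB Require Import structures.
From mathcomp Require Import all_fingroup.
From mathcomp Require Import all_boot all_order all_algebra.
From mathcomp Require Import boolp classical_sets cardinality.
From mathcomp Require Import finmap.
From mathcomp.multinomials Require Import xfinmap monalg.

Set Implicit Arguments.
Unset Strict Implicit.
Unset Printing Implicit Defensive.

Import GRing.Theory.
Local Open Scope ring_scope.
Local Open Scope quotient_scope.

Section TensorPower.
Variables (k : fieldType) (V : lmodType k) (d : nat).

Definition ffun_set (v : {ffun 'I_d -> V}) (i : 'I_d) (a : V) :
    {ffun 'I_d -> V} :=
  [ffun j => if j == i then a else v j].

Definition multilinear (W : lmodType k) (f : {ffun 'I_d -> V} -> W) : Prop :=
  forall (v : {ffun 'I_d -> V}) (i : 'I_d) (c : k) (a b : V),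
    f (ffun_set v i (c *: a + b)) =
    c *: f (ffun_set v i a) + f (ffun_set v i b).

(* The d-th tensor power of V, for V of arbitrary dimension, is the free
   k-module on V^d modulo the submodule spanned by the multilinearity
   relations. *)
Local Notation free_tensor := {malg k[{ffun 'I_d -> V}]}.
Local Notation delta v := (<< 1 *g v >> : free_tensor).

Inductive tensor_rel : free_tensor -> Prop :=
| tensor_rel_gen v i c a b :
    tensor_rel (delta (ffun_set v i (c *: a + b)) -
                (c *: delta (ffun_set v i a) + delta (ffun_set v i b)))
| tensor_rel0 : tensor_rel 0
| tensor_relP c t u : tensor_rel t -> tensor_rel u -> tensor_rel (c *: t + u).

Definition tensor_relb : {pred free_tensor} := [pred t | `[< tensor_rel t >]].

Lemma tensor_relbP t : reflect (tensor_rel t) (t \in tensor_relb).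
Proof. exact: asboolP. Qed.

Lemma tensor_rel_zmod_closed : zmod_closed tensor_relb.
Proof.
split=> [|t u /tensor_relbP ht /tensor_relbP hu]; apply/tensor_relbP.
  exact: tensor_rel0.
by rewrite addrC -scaleN1r; apply: tensor_relP.
Qed.

HB.instance Definition _ :=
  GRing.isZmodClosed.Build free_tensor tensor_relb tensor_rel_zmod_closed.

Lemma tensor_relZ c t : t \in tensor_relb -> c *: t \in tensor_relb.
Proof.
move=> /tensor_relbP ht; apply/tensor_relbP.
by rewrite -[_ *: _]addr0; apply: tensor_relP => //; apply: tensor_rel0.
Qed.

Definition tensor_power : Type := Quotient.quot tensor_relb.

HB.instance Definition _ := GRing.Zmodule.on tensor_power.

Definition tensor_class (t : free_tensor) : tensor_power :=
  \pi_(Quotient.quot tensor_relb) t.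

Definition tensor_scale (c : k) (t : tensor_power) : tensor_power :=
  tensor_class (c *: repr (t : Quotient.quot tensor_relb)).

Lemma tensor_classE t u : (tensor_class t = tensor_class u) <-> tensor_rel (t - u).
Proof.
split=> [/eqP|/tensor_relbP]; rewrite -?Quotient.idealrBE.
  by move/tensor_relbP.
by rewrite Quotient.idealrBE => /eqP.
Qed.

Lemma tensor_classD : {morph tensor_class : t u / t + u}.
Proof. by move=> t u; rewrite /tensor_class raddfD. Qed.

Lemma tensor_class_surj (t : tensor_power) : exists u, t = tensor_class u.
Proof. by exists (repr (t : Quotient.quot tensor_relb)); rewrite /tensor_class reprK. Qed.

Lemma tensor_class_scale c t : tensor_class (c *: t) = tensor_scale c (tensor_class t).
Proof.
apply/tensor_classE/tensor_relbP; rewrite -scalerBr.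
apply/tensor_relZ/tensor_relbP/tensor_classE.
by rewrite /tensor_class reprK.
Qed.

Lemma tensor_scaleA a b t :
  tensor_scale a (tensor_scale b t) = tensor_scale (a * b) t.
Proof.
by have [u ->] := tensor_class_surj t; rewrite -!tensor_class_scale scalerA.
Qed.

Lemma tensor_scale1 : left_id 1 tensor_scale.
Proof.
by move=> t; have [u ->] := tensor_class_surj t; rewrite -tensor_class_scale scale1r.
Qed.

Lemma tensor_scaleDr : right_distributive tensor_scale +%R.
Proof.
move=> c t u; have [t' ->] := tensor_class_surj t.
have [u' ->] := tensor_class_surj u.
by rewrite -tensor_classD -!tensor_class_scale scalerDr tensor_classD.
Qed.

Lemma tensor_scaleDl t : {morph tensor_scale^~ t : a b / a + b}.
Proof.
move=> a b; have [u ->] := tensor_class_surj t.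
by rewrite -!tensor_class_scale scalerDl tensor_classD.
Qed.

HB.instance Definition _ := GRing.Zmodule_isLmodule.Build k tensor_power
  tensor_scaleA tensor_scale1 tensor_scaleDr tensor_scaleDl.

Lemma tensor_class_linear : linear tensor_class.
Proof. by move=> c t u; rewrite tensor_classD tensor_class_scale. Qed.

HB.instance Definition _ :=
  GRing.isLinear.Build k free_tensor tensor_power _ tensor_class
    tensor_class_linear.

Definition pure_tensor (v : {ffun 'I_d -> V}) : tensor_power :=
  tensor_class (delta v).

Lemma pure_tensor_multilinear : multilinear pure_tensor.
Proof.
move=> v i c a b; rewrite /pure_tensor -tensor_class_linear.
by apply/tensor_classE; apply: tensor_rel_gen.
Qed.

Section Universal.
Variables (W : lmodType k) (f : {ffun 'I_d -> V} -> W).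

Definition free_lift (t : free_tensor) : W := \sum_(v <- msupp t) t@_v *: f v.

Lemma free_liftE (D : {fset {ffun 'I_d -> V}}) (t : free_tensor) :
  (msupp t `<=` D)%fset -> free_lift t = \sum_(v <- D) t@_v *: f v.
Proof.
move=> le; rewrite /free_lift (big_fset_incl _ le) //= => v _ /mcoeff_outdom ->.
by rewrite scale0r.
Qed.

Lemma free_lift_linear c t u :
  free_lift (c *: t + u) = c *: free_lift t + free_lift u.
Proof.
pose D := (msupp (c *: t + u) `|` msupp t `|` msupp u)%fset.
rewrite !(@free_liftE D) /D; first last.
- by rewrite -fsetUA fsubsetUl.
- by rewrite fsubsetU // fsubsetUr.
- by rewrite fsubsetUr.
rewrite scaler_sumr -big_split; apply: eq_bigr => v _ /=.
by rewrite mcoeffD mcoeffZ scalerDl scalerA.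
Qed.

Lemma free_lift_delta v : free_lift (delta v) = f v.
Proof.
rewrite (free_liftE (msuppU_le (k := v) (x := 1))).
by rewrite big_seq_fset1 mcoeffUU scale1r.
Qed.

Hypothesis f_multilinear : multilinear f.

Lemma free_lift_rel t : tensor_rel t -> free_lift t = 0.
Proof.
elim=> [v i c a b||c {}t u _ t0 _ u0].
- rewrite -scaleN1r addrC !free_lift_linear !free_lift_delta f_multilinear.
  by rewrite scaleN1r addNr.
- by rewrite -(addNr (0 : free_tensor)) -scaleN1r free_lift_linear scaleN1r addNr.
- by rewrite free_lift_linear t0 u0 scaler0 addr0.
Qed.

Definition tensor_lift (t : tensor_power) : W :=
  free_lift (repr (t : Quotient.quot tensor_relb)).

Lemma tensor_lift_class t : tensor_lift (tensor_class t) = free_lift t.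
Proof.
apply/eqP; rewrite -subr_eq0 addrC -scaleN1r -free_lift_linear; apply/eqP.
apply: free_lift_rel; rewrite scaleN1r addrC; apply/tensor_classE.
by rewrite /tensor_class reprK.
Qed.

Lemma tensor_lift_linear : linear tensor_lift.
Proof.
move=> c t u; have [t' ->] := tensor_class_surj t.
have [u' ->] := tensor_class_surj u.
by rewrite -tensor_class_linear !tensor_lift_class free_lift_linear.
Qed.

Lemma tensor_lift_pure v : tensor_lift (pure_tensor v) = f v.
Proof. by rewrite tensor_lift_class free_lift_delta. Qed.

End Universal.

Lemma tensor_power_universal (W : lmodType k) (f : {ffun 'I_d -> V} -> W) :
  multilinear f ->
  exists2 F : {linear tensor_power -> W},
    forall v, F (pure_tensor v) = f v &
    forall F' : {linear tensor_power -> W},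
      (forall v, F' (pure_tensor v) = f v) -> F' =1 F.
Proof.
move=> fM.
pose FM := GRing.isLinear.Build _ _ _ _ (tensor_lift f) (tensor_lift_linear fM).
pose F : {linear tensor_power -> W} := HB.pack (tensor_lift f) FM.
exists F => [v|F' F'E t]; first exact: tensor_lift_pure.
have [u ->] := tensor_class_surj t; rewrite /= tensor_lift_class //.
rewrite {1}[u]monalgE !raddf_sum /=.
apply: eq_bigr => v _; rewrite -F'E -linearZ /= -linearZ.
congr (F' (tensor_class _)).
by apply/malgP => w; rewrite mcoeffZ !mcoeffU mulrnAr mulr1.
Qed.

Definition tensor_exp (x : V) : tensor_power := pure_tensor [ffun=> x].

End TensorPower.

Record representation (k : fieldType) (G : finGroupType) (V : lmodType k) :=
  Representation {
    repr_act :> G -> {linear V -> V};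
    repr_act1 : forall v, repr_act 1%g v = v;
    repr_actM : forall g h v, repr_act (g * h)%g v = repr_act g (repr_act h v)
  }.

Definition invariant_tensor (k : fieldType) (G : finGroupType)
    (V : lmodType k) (rho : representation G V) (d : nat) (x : V) :
    tensor_power V d :=
  \sum_(g : G) tensor_exp d (rho g x).

Definition linearly_independent (k : fieldType) (V : lmodType k) (I : finType)
    (v : I -> V) : Prop :=
  forall c : I -> k, \sum_(i : I) c i *: v i = 0 -> forall i, c i = 0.

(* Main.v *)
(** Contracting [T2] with the functionals dual to the orbit [x_a] of [x] shows
    that the coordinate matrix [Y] of the orbit of [y] satisfies [Y^T Y = 1],
    hence [Y Y^T = 1], and that the orbit of [y] lies in the span of the [x_a].
    Contracting [T3] gives [sum_g Y g a * Y g b * Y g c = 1] if [a = b = c] and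
    [0] otherwise; multiplying by [Y] in the last index yields
    [Y g a * Y g b = (a == b) * Y g a], so every row of [Y] is a standard basis
    vector. *)
From HB Require Import structures.
Require Import Defs.
From mathcomp Require Import all_boot all_order all_algebra all_fingroup.
From mathcomp Require Import boolp classical_sets cardinality.

Set Implicit Arguments.
Unset Strict Implicit.
Unset Printing Implicit Defensive.

Import GRing.Theory.
Local Open Scope ring_scope.

Section DualFamily.
Variables (k : fieldType) (V : lmodType k) (I : finType) (v : I -> V).

(* Allowing [A] to be empty lets the union of the empty chain qualify in
   Zorn's lemma. *)
Let avoids_span (A : set V) : Prop :=
  (forall c a b, A a -> A b -> A (c *: a + b)) /\
  (forall c : I -> k, A (\sum_i c i *: v i) -> \sum_i c i *: v i = 0).

(** A maximal subspace meeting the span of [v] only in 0 is a complement of that span. Zorn's lemma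
    supplies it, as [V] may be infinite-dimensional. *)
Lemma span_complement :
  exists A : set V,
    [/\ A 0, forall c a b, A a -> A b -> A (c *: a + b),
        forall c : I -> k, A (\sum_i c i *: v i) -> \sum_i c i *: v i = 0 &
        forall w, exists c : I -> k, A (w - \sum_i c i *: v i)].
Proof.
have [F FP Ftot|A [[Alin Aspan] Amax]] := @Zorn_bigcup V avoids_span.
  split=> [c a b [X FX Xa] [Z FZ Zb]|c [X FX Xc]]; last exact: (FP X FX).2.
  have [XZ|ZX] := Ftot X Z FX FZ.
    by exists Z => //; apply: (FP Z FZ).1 => //; apply: XZ.
  by exists X => //; apply: (FP X FX).1 => //; apply: ZX.
have A0 : A 0.
  have [[a Aa]|A_empty] := pselect (exists a, A a).
    by rewrite -[0](addNr a) -scaleN1r; apply: Alin.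
  (* An empty [A] would lie strictly below the zero subspace, against maximality. *)
  exfalso; apply: (Amax [set 0]%classic); last first.
    split=> [c a b -> ->|c //]; by rewrite /= scaler0 addr0.
  split=> [a Aa|sub]; first by case: A_empty; exists a.
  by apply: A_empty; exists 0; apply: sub.
exists A; split=> // w; apply: contrapT => w_out.
(* If [w] were outside [A] plus the span, adjoining the line through [w] to [A] would contradict
   maximality. *)
pose B : set V := fun u => exists c a, A a /\ u = c *: w + a.
apply: (Amax B); last first.
  split=> [c a b [ca [a' [Aa' ->]]] [cb [b' [Ab' ->]]]|c [d [a [Aa cE]]]].
    exists (c * ca + cb), (c *: a' + b'); split; first exact: Alin.
    by rewrite scalerDr scalerA scalerDl addrACA.
  have [d0|d_neq0] := eqVneq d 0.
    by apply: Aspan; rewrite cE d0 scale0r add0r.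
  (* Solving [d *: w + a] = (a span element) for [w] puts [w] in [A] plus the span. *)
  case: w_out; exists (fun i => d^-1 * c i).
  rewrite (eq_bigr (fun i => d^-1 *: (c i *: v i))) => [|i _]; last first.
    by rewrite scalerA.
  rewrite -scaler_sumr cE scalerDr scalerA mulVf // scale1r opprD addNKr.
  by rewrite -scaleNr -[_ *: a]addr0; apply: Alin.
split=> [a Aa|sub].
  by exists 0, a; rewrite scale0r add0r.
apply: w_out; exists (fun=> 0).
rewrite big1 => [|i _]; last by rewrite scale0r.
by rewrite subr0; apply: sub; exists 1, 0; rewrite scale1r addr0.
Qed.

(** [phi i] reads off the [i]-th coordinate of the projection onto the span along the complement
    [A]. Uniqueness of coordinates gives both linearity and the dual values. *)
Lemma dual_family : linearly_independent v ->
  exists phi : I -> {linear V -> k^o},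
    forall i j, phi i (v j) = (i == j)%:R.
Proof.
move=> v_free; have [A [A0 Alin Aspan Acompl]] := span_complement.
have [c cP] := choice Acompl.
have c_uniq w d : A (w - \sum_i d i *: v i) -> forall i, c w i = d i.
  move=> Ad i; apply/eqP; rewrite -subr_eq0; apply/eqP.
  apply: (v_free (fun i => c w i - d i)); apply: Aspan.
  under eq_bigr do rewrite scalerBl.
  rewrite sumrB.
  have := Alin (-1) _ _ (cP w) Ad.
  by rewrite scaleN1r opprB addrA subrK.
have c_lin i : linear (c^~ i : V -> k^o).
  move=> e a b; apply: (c_uniq _ (fun i => e * c a i + c b i)).
  under eq_bigr do rewrite scalerDl -scalerA.
  rewrite big_split /= -scaler_sumr opprD addrACA -scalerBr.
  exact: Alin.
pose phi i : {linear V -> k^o} :=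
  HB.pack (c^~ i : V -> k^o) (GRing.isLinear.Build _ _ _ _ _ (c_lin i)).
exists phi => i j; apply: (c_uniq _ (fun i => (i == j)%:R)).
rewrite (bigD1 j) //= eqxx scale1r big1 ?addr0 ?subrr // => l /negPf ->.
by rewrite scale0r.
Qed.

End DualFamily.

Lemma sum_deltal (k : pzRingType) (V : lmodType k) (I : finType) (i : I)
    (F : I -> V) :
  \sum_j (i == j)%:R *: F j = F i.
Proof.
rewrite (bigD1 i) //= eqxx scale1r big1 ?addr0 // => j.
by rewrite eq_sym => /negPf ->; rewrite scale0r.
Qed.

Lemma orthonormal_cols_rows (k : comPzRingType) (I : finType) (Y : I -> I -> k) :
  (forall a b, \sum_i Y i a * Y i b = (a == b)%:R) ->
  forall i j, \sum_a Y i a * Y j a = (i == j)%:R.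
Proof.
move=> Ycols i j.
pose M := \matrix_(p < #|I|, q < #|I|) Y (enum_val p) (enum_val q).
have /mulmx1C/matrixP/(_ (enum_rank i) (enum_rank j)) : M^T *m M = 1%:M.
  apply/matrixP => a b; rewrite !mxE -(inj_eq enum_val_inj) -Ycols.
  rewrite [RHS](reindex _ (onW_bij _ (@enum_val_bij I))).
  by apply: eq_bigr => p _; rewrite !mxE.
rewrite !mxE (inj_eq enum_rank_inj) => <-.
rewrite (reindex _ (onW_bij _ (@enum_val_bij I))).
by apply: eq_bigr => p _; rewrite !mxE !enum_rankK.
Qed.

Section PowerSums.
Variables (k : fieldType) (V : lmodType k) (I : finType).
Implicit Types u v : I -> V.

(** By the universal property, [f] factors through a linear map on the tensor power. *)
Lemma multilinear_power_sum d (W : lmodType k) (f : {ffun 'I_d -> V} -> W) u v :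
  multilinear f ->
  \sum_i tensor_exp d (u i) = \sum_i tensor_exp d (v i) ->
  \sum_i f [ffun=> u i] = \sum_i f [ffun=> v i].
Proof.
move=> /tensor_power_universal[F FE _] /(congr1 F).
by rewrite !raddf_sum !(eq_bigr _ (fun i _ => FE _)).
Qed.

(** Only the first factor is contracted: keeping the second in [V] later shows that each [v a] is a
    combination of the [u h]. *)
Lemma contract_power_sum2 (phi : {linear V -> k^o}) u v :
  \sum_i tensor_exp 2 (u i) = \sum_i tensor_exp 2 (v i) ->
  \sum_i phi (u i) *: u i = \sum_i phi (v i) *: v i.
Proof.
pose f (w : {ffun 'I_2 -> V}) : V := phi (w ord0) *: w ord_max.
have fM : multilinear f.
  move=> w [[|[|//]] lti] c a b; rewrite /f !ffunE /=.
    by rewrite linearP scalerDl scalerA.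
  by rewrite scalerDr !scalerA mulrC.
move/(multilinear_power_sum fM); rewrite /f.
by under eq_bigr do rewrite !ffunE; under [in RHS]eq_bigr do rewrite !ffunE.
Qed.

Lemma contract_power_sum3 (phi psi : {linear V -> k^o}) u v :
  \sum_i tensor_exp 3 (u i) = \sum_i tensor_exp 3 (v i) ->
  \sum_i (phi (u i) * psi (u i)) *: u i =
  \sum_i (phi (v i) * psi (v i)) *: v i.
Proof.
pose f (w : {ffun 'I_3 -> V}) : V :=
  (phi (w ord0) * psi (w (inord 1))) *: w ord_max.
have fM : multilinear f.
  move=> w [[|[|[|//]]] lti] c a b; rewrite /f !ffunE -!val_eqE /= !inordK //=.
  - by rewrite linearP mulrDl scalerDl scalerA mulrA.
  - by rewrite linearP mulrDr scalerDl scalerA mulrCA.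
  - by rewrite scalerDr !scalerA [c * _]mulrC.
move/(multilinear_power_sum fM); rewrite /f.
by under eq_bigr do rewrite !ffunE; under [in RHS]eq_bigr do rewrite !ffunE.
Qed.

Theorem power_sums23_determine u v : linearly_independent v ->
  \sum_i tensor_exp 2 (u i) = \sum_i tensor_exp 2 (v i) ->
  \sum_i tensor_exp 3 (u i) = \sum_i tensor_exp 3 (v i) ->
  forall i, exists j, u i = v j.
Proof.
move=> /dual_family[phi phiE] uv2 uv3 i.
pose Y i a : k := phi a (u i).
have vE a : \sum_h Y h a *: u h = v a.
  rewrite (contract_power_sum2 _ uv2) -[RHS](sum_deltal a).
  by apply: eq_bigr => j _; rewrite phiE.
have Ycols a b : \sum_h Y h a * Y h b = (a == b)%:R.
  rewrite eq_sym -phiE -vE linear_sum.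
  by apply: eq_bigr => h _; rewrite linearZ.
have Yrows := orthonormal_cols_rows Ycols.
(* Orthonormality of the rows inverts the expansion [vE]. *)
have uE g : u g = \sum_a Y g a *: v a.
  rewrite -[LHS](sum_deltal g).
  under eq_bigr do rewrite -Yrows scaler_suml.
  rewrite exchange_big; apply: eq_bigr => a _ /=.
  by rewrite -vE scaler_sumr; apply: eq_bigr => h _; rewrite scalerA.
have vE3 a b : \sum_h (Y h a * Y h b) *: u h = (a == b)%:R *: v a.
  rewrite (contract_power_sum3 _ _ uv3) -[v a](sum_deltal a) scaler_sumr.
  apply: eq_bigr => h _; rewrite !phiE scalerA.
  by have [->|] := eqVneq a h; rewrite ?mulr0 ?mul0r // eq_sym mulrC.
have Ymul g a b : Y g a * Y g b = (a == b)%:R * Y g a.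
  have Ycubic c : \sum_h Y h c * (Y h a * Y h b) = (a == b)%:R * (c == a)%:R.
    have := congr1 (phi c) (vE3 a b); rewrite linearZ linear_sum /= phiE.
    move=> E; apply: etrans E.
    by apply: eq_bigr => h _; rewrite linearZ /= mulrC.
  (* Writing the product as a delta sum over [h] and replacing the delta by the pairing of rows [g]
     and [h] brings in a third factor [Y h c], so that [Ycubic] applies. *)
  rewrite -[LHS](@sum_deltal k k^o I g (fun h => Y h a * Y h b)).
  under eq_bigr do rewrite -Yrows scaler_suml.
  rewrite exchange_big /= -[in RHS](@sum_deltal k k^o I a (Y g)) mulr_sumr.
  apply: eq_bigr => c _.
  rewrite [_ *: _]/(_ * _) mulrA [a == c]eq_sym -Ycubic mulr_suml.
  by apply: eq_bigr => h _; rewrite -scalerA; apply: mulrC.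
(* Row [i] pairs with itself to 1, so it is not zero. *)
have [a Ya_neq0] : exists a, Y i a != 0.
  apply: contrapT => Yi0; have := Yrows i i.
  rewrite eqxx big1 => [/eqP|a _]; first by rewrite eq_sym oner_eq0.
  suff -> : Y i a = 0 by rewrite mul0r.
  by apply: contrapT => /eqP Ya; apply: Yi0; exists a.
exists a; rewrite uE -[RHS](sum_deltal a).
(* Cancelling [Y i a] in [Ymul] leaves [Y i b = (a == b)%:R]. *)
apply: eq_bigr => b _; congr (_ *: _); apply: (mulfI Ya_neq0).
by rewrite Ymul mulrC.
Qed.

End PowerSums.

Theorem mainTheorem1 (k : fieldType) (k_infinite : infinite_set [set: k]%classic)
    (G : finGroupType) (V : lmodType k) (rho : representation G V) (x : V)
    (x_free : linearly_independent (fun g : G => rho g x)) (y : V)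
    (T2 : invariant_tensor rho 2 y = invariant_tensor rho 2 x)
    (T3 : invariant_tensor rho 3 y = invariant_tensor rho 3 x) :
  exists g : G, y = rho g x.
Proof.
(* The index [1%g] picks out [y] itself in its orbit. *)
have [g yE] := @power_sums23_determine _ _ _ (rho^~ y) _ x_free T2 T3 1%g.
by exists g; rewrite -yE repr_act1.
Qed.
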